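(* Let $F$ and $F'$ be connected open 2-digraphs all of whose alternating cycles are odd, each having exactly $n>0$ exit vertices (hence $n$ entry vertices). Label the entry vertices and the exit vertices of each of $F,F'$ by $1,\dots,n$, and let $P,Q\subseteq S_n$ be the sets of permutations corresponding to the open routes of $F$ and $F'$ respectively. Let $x,y\in S_n$ and let $G=\mathcal{S}(F,F',x,y)$ be the spliced 2-dd. Assume that $(n,P,Q,x,y)$ satisfies the parity condition. Then the following are equivalent: (i) $G$ is non-Hamiltonian; (ii) $xQy\subseteq R_P$; (iii) $yPx\subseteq R_Q$.
   Context: **Permutations.** $S_n$ is the symmetric group on $\{1,\dots,n\}$, $A_n$ the set of even permutations, $\overline{A}_n=S_n-A_n$ the set of odd ones, and $C_n\subset S_n$ the set of permutations consisting of a single cycle of length $n$. Products are composed from left to right, so $pxqy$ maps $i$ to $y(q(x(p(i))))$. A set $P\subseteq S_n$ is uniform if it is non-empty and either $P\subseteq A_n$ (even, $\pi(P)=0$) or $P\subseteq\overline{A}_n$ (odd, $\pi(P)=1$). For a permutation $p$, $\pi(p)=0$ if $p$ is even and $1$ if odd; for an integer $n$, $\pi(n)=0$ if $n$ is even and $1$ if odd. For sets, $xQy=\{xqy: q\in Q\}$ and $P^{-1}C_n=\{p^{-1}c: p\in P, c\in C_n\}$. For uniform $P$, the excluded set is $E_P=P^{-1}C_n$ and the residue is $R_P=\overline{A}_n-E_P$ if $\pi(P)=\pi(n)$, and $R_P=A_n-E_P$ otherwise. **Parity condition** for $(n,P,Q,x,y)$: one of the following holds: (1) $\pi(n)=0$,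 $\pi(P)=\pi(Q)$, $\pi(x)\ne\pi(y)$; (2) $\pi(n)=0$, $\pi(P)\neq\pi(Q)$, $\pi(x)=\pi(y)$; (3) $\pi(n)=1$, $\pi(P)=\pi(Q)$, $\pi(x)=\pi(y)$; (4) $\pi(n)=1$, $\pi(P)\ne\pi(Q)$, $\pi(x)\neq\pi(y)$. **Graphs.** A 2-digraph is a finite digraph in which each vertex has (in-degree, out-degree) equal to $(0,2)$ (an entry vertex), $(2,0)$ (an exit vertex) or $(2,2)$ (a saturated vertex). A 2-dd is a 2-digraph all of whose vertices are saturated. Connected means that the underlying undirected graph is connected. An alternating cycle (AC) is a sequence of $2r$ distinct arcs $(e_0,\dots,e_{2r-1})$ such that $e_i$ and $e_{i+1}$ (indices mod $2r$) have a common end-vertex if $i$ is even and a common start-vertex if $i$ is odd; its forward arcs are the $e_i$ with $i$ even and its backward arcs those with $i$ odd. The AC is odd if $r$ is odd. The arc set of a 2-digraph is uniquely partitioned into ACs. A factor of a 2-digraph is a spanning subgraph which, for every AC, contains either all its forward arcs and none of its backward arcs, or vice versa; it is a disjoint union of simple directed cycles and simple directed paths from entry vertices to exit vertices. A factor is open if it contains no cycle; a 2-digraph is open if it has at least one open factor. The route of a factor is the bijection from entry vertices to exit vertices sending each entry vertex to the end of the path of the factor starting there; a route is open if it is the route of at least one open factor. With entry and exit vertices labelled by $1,\dots,n$, a route is a permutation in $S_n$. When all ACs are odd, the set of open routes of an open 2-digraph is uniform. **Splicing.** $\mathcal{S}(F,F',x,y)$ is the 2-dd obtained from the disjoint union of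 $F$ and $F'$ by identifying, for each $i$, exit vertex $i$ of $F$ with entry vertex $x(i)$ of $F'$, and exit vertex $i$ of $F'$ with entry vertex $y(i)$ of $F$. A 2-dd is Hamiltonian if it has a directed cycle through all vertices. *)

(* Defs.v *)
From HB Require Import structures.
From mathcomp Require Import all_boot all_fingroup all_solvable.
From mathcomp Require Import boolp.

Set Implicit Arguments.
Unset Strict Implicit.
Unset Printing Implicit Defensive.

Local Open Scope group_scope.

(* Labels are 0, .., n-1, and the product of {perm _} composes from left to
   right: (p * q) i = q (p i). *)

(* Fixed points are cycles of length 1 in [porbits], so a permutation with
   exactly one orbit is a single cycle of length n. *)
Definition full_cycles n : {set 'S_n} := [set c : 'S_n | #|porbits c| == 1%N].

(* [true] stands for odd.  This is the parity of a uniform set (non-empty, all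
   elements of the same parity); the value is meaningless on other sets. *)
Definition set_parity n (P : {set 'S_n}) : bool := ~~ (P \subset 'Alt_('I_n)).

Definition excluded_set n (P : {set 'S_n}) : {set 'S_n} :=
  P^-1 * full_cycles n.

Definition residue n (P : {set 'S_n}) : {set 'S_n} :=
  if set_parity P == odd n then ~: 'Alt_('I_n) :\: excluded_set P
  else 'Alt_('I_n) :\: excluded_set P.

Definition parity_condition n (P Q : {set 'S_n}) (x y : 'S_n) : Prop :=
  [\/ [/\ ~~ odd n, set_parity P = set_parity Q & odd_perm x <> odd_perm y],
      [/\ ~~ odd n, set_parity P <> set_parity Q & odd_perm x = odd_perm y],
      [/\ odd n, set_parity P = set_parity Q & odd_perm x = odd_perm y]
    | [/\ odd n, set_parity P <> set_parity Q & odd_perm x <> odd_perm y]].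

(* Loops and parallel arcs are allowed; simple digraphs are the case where
   a |-> (src a, tgt a) is injective. *)

Record digraph := Digraph {
  vertex : finType;
  arc : finType;
  src : arc -> vertex;
  tgt : arc -> vertex }.

Section Digraph.
Variable D : digraph.
Implicit Types (u v : vertex D) (a : arc D) (c : seq (arc D)) (M : {set arc D}).

Definition indeg v := #|[set a | tgt a == v]|.
Definition outdeg v := #|[set a | src a == v]|.

Definition entries : {set vertex D} :=
  [set v | (indeg v == 0%N) && (outdeg v == 2)].
Definition exits : {set vertex D} :=
  [set v | (indeg v == 2) && (outdeg v == 0%N)].
Definition saturated : {set vertex D} :=
  [set v | (indeg v == 2) && (outdeg v == 2)].

Definition two_digraph : Prop :=
  forall v, [|| v \in entries, v \in exits | v \in saturated].

Definition connected : Prop :=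
  forall u v, connect (fun u v => [exists a,
    ((src a == u) && (tgt a == v)) || ((src a == v) && (tgt a == u))]) u v.

Definition alternating_cycle r (e : 'I_r.*2 -> arc D) : Prop :=
  [/\ 0 < r, injective e &
      forall i : 'I_r.*2, if odd i then src (e i) = src (e (ordS i))
                else tgt (e i) = tgt (e (ordS i))].

Definition forward_arcs r (e : 'I_r.*2 -> arc D) : {set arc D} :=
  [set e i | i : 'I_r.*2 & ~~ odd i].
Definition backward_arcs r (e : 'I_r.*2 -> arc D) : {set arc D} :=
  [set e i | i : 'I_r.*2 & odd i].

Definition all_ACs_odd : Prop :=
  forall r (e : 'I_r.*2 -> arc D), alternating_cycle e -> odd r.

(* A spanning subgraph is given by its set of arcs. *)
Definition factor M : Prop :=
  forall r (e : 'I_r.*2 -> arc D), alternating_cycle e ->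
    (forward_arcs e \subset M /\ [disjoint backward_arcs e & M]) \/
    (backward_arcs e \subset M /\ [disjoint forward_arcs e & M]).

(* [diwalk u c v]: the arcs of c, in order, form a directed walk from u to v. *)
Fixpoint diwalk u c v : bool :=
  if c is a :: c' then (src a == u) && diwalk (tgt a) c' v else u == v.

Definition dipath u c v : bool := diwalk u c v && uniq (u :: map (@tgt D) c).

Definition dicycle c : Prop :=
  [/\ c != [::], exists u, diwalk u c u & uniq (map (@tgt D) c)].

Definition open_factor M : Prop :=
  factor M /\ ~ exists2 c, dicycle c & {subset c <= M}.

Definition open_digraph : Prop := exists M, open_factor M.

Definition hamiltonian : Prop :=
  exists2 c, dicycle c & forall v, v \in map (@tgt D) c.

End Digraph.

Record labelling n (T : finType) (A : {set T}) := Labelling {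
  label :> 'I_n -> T;
  label_inj : injective label;
  label_im : [set label i | i : 'I_n] = A }.

(* Since the labellings are bijections, there are exactly n entry vertices and
   exactly n exit vertices. *)
Record labelled_digraph n := LabelledDigraph {
  underlying :> digraph;
  entry : labelling n (entries underlying);
  exit : labelling n (exits underlying) }.

Definition route n (F : labelled_digraph n) (M : {set arc F}) (p : 'S_n) : Prop :=
  forall i, exists2 c, dipath (entry F i) c (exit F (p i)) & {subset c <= M}.

(* [boolp] only serves to form this finite set from a Prop-valued predicate. *)
Definition open_routes n (F : labelled_digraph n) : {set 'S_n} :=
  [set p | `[< exists2 M, open_factor M & @route n F M p >]].

Section Splice.
Variables (n : nat) (F F' : labelled_digraph n) (x y : 'S_n).

Definition glued (u : vertex F) (v : vertex F') : bool :=
  [exists i, (u == exit F i) && (v == entry F' (x i))] ||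
  [exists i, (v == exit F' i) && (u == entry F (y i))].

Definition glue (u v : vertex F + vertex F') : bool :=
  match u, v with
  | inl u, inr v | inr v, inl u => glued u v
  | _, _ => false
  end.

Lemma connect_glue_equiv : equiv_class_of (connect glue).
Proof.
have glue_sym : symmetric glue by case=> u [] v.
split; [exact: connect0 | exact/sym_connect_sym | exact: connect_trans].
Qed.

Canonical connect_glue_equivRel := EquivRelPack connect_glue_equiv.

Definition glue_quot := {eq_quot (connect glue)}%qT.
Definition splice_vertex : finType := quot_type glue_quot.

Definition splice_class (v : vertex F + vertex F') : splice_vertex :=
  (\pi_glue_quot v)%qT.

Definition splice : digraph :=
  @Digraph splice_vertex (arc F + arc F')%type
    (fun a => splice_class (match a with inl a => inl (src a) | inr a => inr (src a) end))
    (fun a => splice_class (match a with inl a => inl (tgt a) | inr a => inr (tgt a) end)).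

End Splice.

(* Main.v *)
(** A Hamiltonian cycle of the splice cuts F and F' into open factors, so the
    splice is Hamiltonian iff p x q y is a single n-cycle for some open routes p
    of F and q of F'.  Hence non-Hamiltonicity says that no x q y lies in
    P^-1 C_n, and symmetrically, up to conjugation, that no y p x lies in
    Q^-1 C_n; the parity condition puts x Q y and y P x in the parity class of
    R_P and R_Q, because P and Q are uniform.

    For uniformity, a factor together with arcs from each exit i to entry i gives
    a permutation of the vertices, whose cycles are those of the route when the
    factor is open.  Reversing the choice on an alternating cycle of length 2r
    multiplies this permutation by an r-cycle, which is even as r is odd. *)

From HB Require Import structures.
From mathcomp Require Import all_boot all_fingroup all_solvable.
From mathcomp Require Import boolp.
Require Import Defs.

Set Implicit Arguments.
Unset Strict Implicit.
Unset Printing Implicit Defensive.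

Local Open Scope group_scope.

(** * Orbits, single cycles and parity of permutations *)

Lemma porbit_trans (T : finType) (s : {perm T}) u v w :
  u \in porbit s v -> v \in porbit s w -> u \in porbit s w.
Proof. by rewrite -!eq_porbit_mem => /eqP -> /eqP ->. Qed.

Lemma mem_porbit1 (T : finType) (s : {perm T}) u : s u \in porbit s u.
Proof. by have := mem_porbit s 1 u; rewrite expg1. Qed.

(** The orbits of [s] are the preimages under [l] of the orbits of [r], and taking preimages is
    injective because [k] is a section of [l]. All conditions hold only up to orbits, so [l] may
    stand still while [s] moves, which allows [r] to be a contracted version of [s]. *)
Lemma card_porbits_semiconj (T I : finType) (s : {perm T}) (r : {perm I})
    (l : T -> I) (k : I -> T) :
    cancel k l -> (forall u, l (s u) \in porbit r (l u)) ->
    (forall u, k (l u) \in porbit s u) ->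
    (forall i, k (r i) \in porbit s (k i)) ->
  #|porbits s| = #|porbits r|.
Proof.
move=> kK ls kl kr.
have lporb u v : (v \in porbit s u) = (l v \in porbit r (l u)).
  apply/idP/idP => [/porbitP[m ->]|/porbitP[j lv]].
    elim: m => [|m IH]; first by rewrite expg0 perm1 porbit_id.
    by rewrite expgSr permM; apply: porbit_trans IH.
  have : k (l v) \in porbit s (k (l u)).
    rewrite lv; elim: j {lv} => [|j IH]; first by rewrite expg0 perm1 porbit_id.
    by rewrite expgSr permM; apply: porbit_trans IH.
  move=> klv; have vk : v \in porbit s (k (l v)) by rewrite porbit_sym kl.
  exact: porbit_trans vk (porbit_trans klv (kl u)).
have -> : porbits s = [set l @^-1: (B : {set I}) | B in porbits r].
  apply/setP => B; apply/imsetP/imsetP => [[u _ ->]|[C /imsetP[i _ ->] ->]].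
    exists (porbit r (l u)); first exact: imset_f.
    by apply/setP => v; rewrite inE lporb.
  by exists (k i) => //; apply/setP => v; rewrite inE lporb kK.
apply: card_imset => B C /setP BC; apply/setP => i.
by have := BC (k i); rewrite !inE kK.
Qed.

Lemma card_porbitsC (T : finType) (a b : {perm T}) :
  #|porbits (a * b)| = #|porbits (b * a)|.
Proof.
apply: (@card_porbits_semiconj _ _ _ _ a a^-1) => [i|u|u|i].
- exact: permKV.
- by have := mem_porbit1 (b * a) (a u); rewrite !permM.
- by rewrite permK porbit_id.
- by have := mem_porbit1 (a * b) (a^-1 i); rewrite !permM permK permKV.
Qed.

Lemma card_porbits1P (T : finType) (s : {perm T}) (u : T) :
  reflect (forall v, v \in porbit s u) (#|porbits s| == 1%N).
Proof.
apply: (iffP cards1P) => [[B Bs] v|su].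
  have: porbit s v \in porbits s by apply: imset_f.
  have: porbit s u \in porbits s by apply: imset_f.
  by rewrite Bs !inE -eq_porbit_mem => /eqP-> /eqP->.
exists (porbit s u); apply/setP => B; rewrite inE.
apply/imsetP/eqP => [[v _ ->]|->]; last by exists u.
by apply/eqP; rewrite eq_porbit_mem.
Qed.

(** The product [m] of the chosen periods is odd and [t ^+ m = 1], while an odd power of [t] has the
    parity of [t]. *)
Lemma even_perm_odd_periods (T : finType) (t : {perm T}) :
  (forall v, exists2 r, odd r & (t ^+ r) v = v) -> ~~ odd_perm t.
Proof.
move=> /fin_all_exists2[r r_odd tr]; set m := (\prod_v r v)%N.
have m_odd : odd m by apply: (big_ind odd) => // a b; rewrite oddM => -> ->.
have tm : t ^+ m = 1.
  apply/permP => v; rewrite perm1 /m (bigD1 v) //= expgM.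
  by elim: (\prod_(i | _) _)%N => [|j IH];
    rewrite ?expg0 ?perm1 // expgS permM tr.
have odd_permX j : odd_perm (t ^+ j) = odd j && odd_perm t.
  elim: j => [|j IH]; first by rewrite expg0 odd_perm1.
  by rewrite expgS odd_permM IH /=; case: (odd j) (odd_perm t) => [] [].
by have := odd_permX m; rewrite tm odd_perm1 m_odd /= => <-.
Qed.

Lemma connect_sink_unique (T : finType) (e : rel T) v x y :
    (forall u v w, e u v -> e u w -> v = w) ->
    (forall w, ~~ e x w) -> (forall w, ~~ e y w) ->
  connect e v x -> connect e v y -> x = y.
Proof.
move=> e_det ex ey /connectP[p ep xE].
elim: p v ep xE => [|w p IH] v /=.
  by move=> _ <- /connectP[[|w q] /= + ->] //; rewrite (negbTE (ex w)).
move=> /andP[vw wp] xE /connectP[[|w' q] /=].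
  by move=> _ yE; move: (ey w); rewrite yE vw.
case/andP=> vw' wq yE; apply: (IH w) => //.
by rewrite (e_det _ _ _ vw vw'); apply/connectP; exists q.
Qed.

(** Exactly one element of [M] in each nonempty fibre of [f]. Imposed on both the source and the
    target map, this describes factors without mention of alternating cycles. *)
Definition transversal (A B : finType) (f : A -> B) (M : {set A}) :=
  {in M &, injective f} /\ forall a, exists2 b, b \in M & f b = f a.

(** * Directed walks inside a set of arcs *)

Section Walks.
Variable D : digraph.
Implicit Types (u v : vertex D) (a : arc D) (c : seq (arc D)) (M : {set arc D}).

Definition arc_rel M u v := [exists a in M, (src a == u) && (tgt a == v)].

Lemma arc_relP M u v :
  reflect (exists a, [/\ a \in M, src a = u & tgt a = v]) (arc_rel M u v).
Proof.
apply: (iffP existsP) => [[a /and3P[aM /eqP ? /eqP ?]]|[a [aM ? ?]]]; exists a => //.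
by apply/and3P; split=> //; apply/eqP.
Qed.

Lemma arc_rel_arc M a : a \in M -> arc_rel M (src a) (tgt a).
Proof. by move=> aM; apply/arc_relP; exists a. Qed.

Lemma diwalk_cat u c1 c2 v :
  diwalk u (c1 ++ c2) v = diwalk u c1 (last u (map (@tgt D) c1)) &&
    diwalk (last u (map (@tgt D) c1)) c2 v.
Proof.
by elim: c1 u => [|a c1 IH] u /=; rewrite ?eqxx //= IH andbA.
Qed.

Lemma diwalk_last u c v : diwalk u c v -> last u (map (@tgt D) c) = v.
Proof. by elim: c u => [|a c IH] u /= => [/eqP|/andP[_ /IH]]. Qed.

Lemma diwalk_path M u c v :
  diwalk u c v -> {subset c <= M} -> path (arc_rel M) u (map (@tgt D) c).
Proof.
elim: c u => [//|a c IH] u /= /andP[/eqP <- cw] cM.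
rewrite arc_rel_arc ?cM ?mem_head //=; apply: IH => // b bc.
by rewrite cM // inE bc orbT.
Qed.

Lemma path_diwalk M u p : path (arc_rel M) u p ->
  exists c, [/\ diwalk u c (last u p), map (@tgt D) c = p & {subset c <= M}].
Proof.
elim: p u => [|v p IH] u /=; first by exists [::]; rewrite /= eqxx.
case/andP => /arc_relP[a [aM <- <-]] /IH[c [cw cp cM]].
exists (a :: c); rewrite /= eqxx cw cp; split=> //.
by move=> b; rewrite inE => /orP[/eqP->|/cM].
Qed.

Lemma connect_dipath M u v :
  connect (arc_rel M) u v <-> exists2 c, dipath u c v & {subset c <= M}.
Proof.
split=> [/connectP[p /shortenP[q qp q_uniq _] ->]|[c /andP[cw _] cM]].
  have [c [cw cq cM]] := path_diwalk qp.
  by exists c; rewrite // /dipath cw cq.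
apply/connectP; exists (map (@tgt D) c); first exact: diwalk_path cw cM.
by rewrite (diwalk_last cw).
Qed.

Lemma diwalk_src u c v :
  diwalk u c v -> rcons (map (@src D) c) v = u :: map (@tgt D) c.
Proof.
by elim: c u => [|a c IH] u /= => [/eqP->|/andP[/eqP<- /IH ->]].
Qed.

Lemma closed_walk_src u c : diwalk u c u ->
  perm_eq (map (@src D) c) (map (@tgt D) c).
Proof.
move/diwalk_src => E; rewrite -(perm_cons u) -E perm_sym.
by rewrite perm_rcons.
Qed.

End Walks.

(** * Closing a factor up into a permutation of the vertices *)

Section Closure.
Variables (D : digraph) (I : finType) (en ex : I -> vertex D) (M : {set arc D}).
Implicit Types (u v : vertex D) (a : arc D) (i j : I) (s : {perm vertex D}).

(** The index type is arbitrary so that one theory serves three cases: a labelled digraph with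
    ['I_n], the disjoint union of two with ['I_n + 'I_n], and the splice, where no terminal is left,
    with the empty type. *)
Definition terminals := [/\ injective en, injective ex,
  forall v, (v \in codom (@tgt D)) = (v \notin codom en),
  forall v, (v \in codom (@src D)) = (v \notin codom ex) &
  forall i j, en i != ex j].

Definition closes s :=
  (forall i, s (ex i) = en i) /\ {in M, forall a, s (src a) = tgt a}.

Hypothesis term : terminals.

Lemma src_ex a i : src a <> ex i.
Proof.
case: term => _ _ _ vex _ ai; have := vex (src a).
by rewrite codom_f ai codom_f.
Qed.

Lemma tgt_en a i : tgt a <> en i.
Proof.
case: term => _ _ ven _ _ ai; have := ven (tgt a).
by rewrite codom_f ai codom_f.
Qed.

Hypotheses (srcM : transversal (@src D) M) (tgtM : transversal (@tgt D) M).

Lemma src_or_ex v : (exists2 a, a \in M & src a = v) \/ exists i, v = ex i.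
Proof.
case: term => _ _ _ vex _; have := vex v.
case: (boolP (v \in codom ex)) => [/codomP[i ->] _|_ /codomP[a ->]].
  by right; exists i.
by left; apply: srcM.2.
Qed.

Lemma closes_exists : exists s, closes s.
Proof.
(* The last default [v] is never taken: by [src_or_ex], a vertex that is not an exit is the source
   of an arc of [M]. *)
pose f v := if [pick i | ex i == v] is Some i then en i else
            if [pick a in M | src a == v] is Some a then tgt a else v.
have f_ex i : f (ex i) = en i.
  rewrite /f; case: pickP => [j /eqP/(let: And5 _ h _ _ _ := term in h)-> //|].
  by move/(_ i); rewrite eqxx.
have f_src a : a \in M -> f (src a) = tgt a.
  move=> aM; rewrite /f; case: pickP => [i /eqP/esym/src_ex //|_].
  case: pickP => [b /andP[bM /eqP/(srcM.1 _ _ bM aM)-> //]|/(_ a)].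
  by rewrite aM eqxx.
have f_inj : injective f.
  move=> u v; case: (src_or_ex u) (src_or_ex v) => [[a aM <-]|[i ->]].
    case=> [[b bM <-]|[i ->]]; rewrite !(f_src, f_ex) //.
      by move/(tgtM.1 _ _ aM bM) ->.
    by move/tgt_en.
  case=> [[b bM <-]|[j ->]]; rewrite !(f_src, f_ex) //.
    by move/esym/tgt_en.
  by case: term => en_inj _ _ _ _ /en_inj ->.
by exists (perm f_inj); split=> [i|a aM]; rewrite permE ?f_ex ?f_src.
Qed.

Lemma arc_rel_det u v w : arc_rel M u v -> arc_rel M u w -> v = w.
Proof.
move=> /arc_relP[a [aM <- <-]] /arc_relP[b [bM ba <-]].
by rewrite (srcM.1 _ _ bM aM ba).
Qed.

Lemma arc_rel_codet u v w : arc_rel M v u -> arc_rel M w u -> v = w.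
Proof.
move=> /arc_relP[a [aM <- <-]] /arc_relP[b [bM <- ba]].
by rewrite (tgtM.1 _ _ bM aM ba).
Qed.

Lemma ex_unique v i j :
  connect (arc_rel M) v (ex i) -> connect (arc_rel M) v (ex j) -> i = j.
Proof.
have ex_sink k w : ~~ arc_rel M (ex k) w.
  by apply/arc_relP => -[a [_ /src_ex]].
case: term => _ ex_inj _ _ _ vi vj; apply: ex_inj.
exact: connect_sink_unique arc_rel_det _ _ vi vj.
Qed.

Lemma en_unique v i j :
  connect (arc_rel M) (en i) v -> connect (arc_rel M) (en j) v -> i = j.
Proof.
have en_source k w : ~~ arc_rel M w (en k).
  by apply/arc_relP => -[a [_ _ /tgt_en]].
case: term => en_inj _ _ _ _ vi vj; apply: en_inj.
(* With the arcs reversed, entries become sinks, and [tgtM] makes the relation deterministic. *)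
pose e := [rel u w | arc_rel M w u].
apply: (@connect_sink_unique _ e v).
- by move=> u w z; apply: arc_rel_codet.
- exact: en_source.
- exact: en_source.
- by rewrite connect_rev.
- by rewrite connect_rev.
Qed.

(** The positive form of the absence of directed cycles in [M]; the two are shown equivalent in
    [acyclic_terminating]. *)
Definition terminating := forall v, exists i, connect (arc_rel M) v (ex i).

Lemma route_exists : terminating ->
  exists p : {perm I}, forall i, connect (arc_rel M) (en i) (ex (p i)).
Proof.
move=> tM; have [f fE] := fin_all_exists (fun i => tM (en i)).
have f_inj : injective f.
  by move=> i j fij; apply: en_unique (fE i) _; rewrite fij.
by exists (perm f_inj) => i; rewrite permE.
Qed.

Section Perm.
Variable s : {perm vertex D}.
Hypothesis sM : closes s.

Lemma arc_rel_closes u v : arc_rel M u v -> s u = v.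
Proof. by case/arc_relP=> a [aM <- <-]; apply: sM.2. Qed.

Lemma connect_closes u v : connect (arc_rel M) u v -> v \in porbit s u.
Proof.
case/connectP=> p + ->; elim: p u => [|w p IH] u /=; first by rewrite porbit_id.
case/andP=> /arc_rel_closes <- /IH wp; apply: porbit_trans wp _.
exact: mem_porbit1.
Qed.

(* The first terminal met on the orbit is reached without leaving [M]. *)
Lemma porbit_terminating : (forall v, exists i, ex i \in porbit s v) -> terminating.
Proof.
move=> orb v; have [i /porbitP[k]] := orb v.
elim: k v => [|k IH] v; first by rewrite expg0 perm1 => <-; exists i.
case: (src_or_ex v) => [[a aM <-]|[j -> _]]; last by exists j; apply: connect0.
rewrite expgS permM sM.2 // => /IH[j aj]; exists j.
exact: connect_trans (connect1 (arc_rel_arc aM)) aj.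
Qed.

(** Let [l] send a vertex to the label of the exit that it reaches. It is constant along the arcs of
    [M], and the jump from [ex i] to [en i] changes it from [i] to [r i]. So [s] is [r] with every
    step stretched into a path. *)
Lemma card_porbits_closure (r : {perm I}) : terminating ->
    (forall i, connect (arc_rel M) (en i) (ex (r i))) ->
  #|porbits s| = #|porbits r|.
Proof.
move=> /fin_all_exists[l lE] rE.
apply: (@card_porbits_semiconj _ _ _ _ l ex) => [i|u|u|i].
- by apply: ex_unique (lE _) _; apply: connect0.
- case: (src_or_ex u) => [[a aM <-]|[i ->]].
    rewrite sM.2 // (ex_unique (lE (src a)) _ : l (src a) = l (tgt a)) ?porbit_id //.
    exact: connect_trans (connect1 (arc_rel_arc aM)) (lE _).
  rewrite sM.1 (ex_unique (lE (en i)) (rE i)).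
  by rewrite (ex_unique (lE (ex i)) (connect0 _ _)) mem_porbit1.
- exact: connect_closes.
- apply: porbit_trans (connect_closes (rE i)) _.
  by rewrite -sM.1 mem_porbit1.
Qed.

(** A walk is recorded by the targets of its arcs, so the orbit is listed from [s v] on. The
    explicit list of targets serves to recognise a Hamiltonian cycle when the orbit is
    everything. *)
Lemma orbit_dicycle v :
    (forall k, arc_rel M (iter k s v) (iter k.+1 s v)) ->
  exists c, [/\ dicycle c, {subset c <= M} &
                map (@tgt D) c = fingraph.orbit s (s v)].
Proof.
move=> vs; have s_inj := @perm_inj _ s.
have: path (arc_rel M) v (traject s (s v) (fingraph.order s v)).
  elim: (fingraph.order s v) => // k IH; rewrite trajectSr rcons_path IH /=.
  by rewrite last_traject -iterSr; apply: vs.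
case/path_diwalk=> c [cw cE cM]; exists c.
have orderE : fingraph.order s (s v) = fingraph.order s v.
  by apply: eq_card => w; apply/esym/(same_fconnect1 s_inj).
rewrite last_traject iter_order // in cw.
split=> //; last by rewrite cE /fingraph.orbit orderE.
split; [|by exists v|].
  rewrite -size_eq0 -(size_map (@tgt D)) cE size_traject.
  by rewrite -lt0n fingraph.order_gt0.
rewrite cE -orderE; exact: fingraph.orbit_uniq.
Qed.

(** Iterating [s] from [v] never meets an exit, hence never jumps: every step is an arc of [M], and
    the finite orbit closes up. *)
Lemma not_terminating_dicycle v : ~ (exists i, connect (arc_rel M) v (ex i)) ->
  exists2 c, dicycle c & {subset c <= M}.
Proof.
move=> vN.
have step u : connect (arc_rel M) v u -> arc_rel M u (s u).
  move=> vu; case: (src_or_ex u) => [[a aM <-]|[i ui]].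
    by rewrite sM.2 // arc_rel_arc.
  by case: vN; exists i; rewrite -ui.
have vs k : connect (arc_rel M) v (iter k s v).
  elim: k => [|k IH]; first exact: connect0.
  exact: connect_trans IH (connect1 (step _ IH)).
by have [k|c [cc cM _]] := @orbit_dicycle v; [apply: step | exists c].
Qed.

(** Out-arcs in [M] are unique, so a path from [v] follows the closed walk. Rotating the closed walk
    along the path makes the end of the path the source of an arc, which an exit is not. *)
Lemma closed_walk_not_terminating v c i : diwalk v c v -> c != [::] ->
  {subset c <= M} -> ~ connect (arc_rel M) v (ex i).
Proof.
move=> vc c0 cM /connectP[p]; elim: p v c vc c0 cM => [|w p IH] v [//|a c] /=.
  by case/andP => /eqP <- _ _ _ _ /esym/src_ex.
case/andP=> /eqP av ac _ cM /andP[vw wp] pE.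
have aM : a \in M by rewrite cM ?mem_head.
have aw : tgt a = w by apply: arc_rel_det vw; rewrite -av arc_rel_arc.
apply: (IH w (rcons c a)) => //; rewrite -?size_eq0 ?size_rcons //.
  rewrite -cats1 diwalk_cat -aw (diwalk_last ac) ac /=.
  by rewrite av !eqxx.
by move=> b; rewrite mem_rcons; apply: cM.
Qed.

Lemma terminatingP : ~ (exists2 c, dicycle c & {subset c <= M}) <-> terminating.
Proof.
split=> [nc v|tM [c [c0 [v vc] _] cM]].
  by apply: contrapT => vN; apply: nc; apply: not_terminating_dicycle vN.
by have [i] := tM v; apply: closed_walk_not_terminating vc c0 cM.
Qed.

End Perm.

Lemma acyclic_terminating :
  ~ (exists2 c, dicycle c & {subset c <= M}) <-> terminating.
Proof. by have [s] := closes_exists; apply: terminatingP. Qed.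

End Closure.

(** * Maps all of whose nonempty fibres have two elements *)

Section Mate.
Variables (A B : finType) (f : A -> B).
Hypothesis f2 : forall a, #|[set b | f b == f a]| = 2.

(** The other element of the fibre of [a]; the default [a] is never taken, by [f2]. *)
Definition mate a := odflt a [pick b | (f b == f a) && (b != a)].

Lemma mateP a : f (mate a) = f a /\ mate a != a.
Proof.
rewrite /mate; case: pickP => [b /andP[/eqP]//|no].
have := f2 a; rewrite (_ : [set b | _] = [set a]) ?cards1 //.
apply/setP => b; rewrite !inE; apply/idP/eqP => [fb|->//].
by apply/eqP; have := no b; rewrite fb /= => /negbFE.
Qed.

Lemma mate_or a b : f b = f a -> b = a \/ b = mate a.
Proof.
have [fm ma] := mateP a; move=> fb.
have E : [set a; mate a] = [set b | f b == f a].
  apply/eqP; rewrite eqEcard f2 cards2 eq_sym ma andbT.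
  by apply/subsetP => c; rewrite !inE => /orP[] /eqP->; rewrite ?fm.
by move/setP/(_ b): E; rewrite !inE fb eqxx => /orP[] /eqP; [left|right].
Qed.

Lemma mateK : involutive mate.
Proof.
move=> a; have [fm ma] := mateP a; have [fmm mma] := mateP (mate a).
by case: (@mate_or a (mate (mate a))) => [|//|E];
  rewrite ?fmm //; move: mma; rewrite E eqxx.
Qed.

Lemma mate_inj : injective mate. Proof. exact: can_inj mateK. Qed.

Lemma transversalP M :
  transversal f M <-> forall a, (mate a \in M) = (a \notin M).
Proof.
split=> [[inj ex] a|mM].
  have [fm ma] := mateP a; have [b bM fb] := ex a.
  case: (boolP (a \in M)) => aM /=.
    by apply/negP => mM; move: ma; rewrite (inj _ _ mM aM fm) eqxx.
  case: (mate_or fb) => E; last by rewrite -E.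
  by move: aM; rewrite -E bM.
split=> [a b aM bM fab|a].
  by case: (mate_or fab) => // E; move: aM; rewrite E mM bM.
case: (boolP (a \in M)) => aM; first by exists a.
by exists (mate a); rewrite ?mM //; case: (mateP a).
Qed.

End Mate.

(** * Alternating cycles, and factors as transversals *)

Section AlternatingCycles.
Variable D : digraph.
Implicit Types (a : arc D) (M : {set arc D}).
Hypothesis D2 : two_digraph D.

Lemma card_src a : #|[set b | src b == src a]| = 2.
Proof.
have : outdeg (src a) != 0%N.
  by rewrite -lt0n; apply/card_gt0P; exists a; rewrite inE.
have := D2 (src a); rewrite !inE -/(outdeg (src a)).
by case/or3P => /andP[_ /eqP->].
Qed.

Lemma card_tgt a : #|[set b | tgt b == tgt a]| = 2.
Proof.
have : indeg (tgt a) != 0%N.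
  by rewrite -lt0n; apply/card_gt0P; exists a; rewrite inE.
have := D2 (tgt a); rewrite !inE -/(indeg (tgt a)).
by case/or3P => /andP[/eqP->].
Qed.

Let ms := mate (@src D).
Let mt := mate (@tgt D).
(** Two steps along an alternating cycle, across the common target and then the common source: from
    a forward arc to the next one. *)
Definition next_forward a := ms (mt a).
Let phi := next_forward.

Let mtK : involutive mt := mateK card_tgt.
Let msK : involutive ms := mateK card_src.

Lemma next_forward_inj : injective phi.
Proof. by move=> a b /(mate_inj card_src)/(mate_inj card_tgt). Qed.

(* [mt] and [ms] generate a dihedral group none of whose reflections fixes an
   arc, since every reflection is conjugate to [mt] or [ms]. *)
Lemma mate_next_forward_neq k a : mt (iter k phi a) != a.
Proof.
suff H j b : mt (iter j phi b) != b /\ mt (iter j.+1 phi b) != b by case: (H k a).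
elim: j b => [|j IH] b.
  split; first by case: (mateP card_tgt b).
  apply/eqP => E; have [_ /eqP] := mateP card_src (mt b); apply.
  by rewrite -/ms -{2}E /= /phi /next_forward mtK.
split; first by case: (IH b).
apply/eqP; rewrite iterS iterSr => E; case: (IH (phi b)) => /eqP + _; apply.
by rewrite [RHS]/phi /next_forward -{2}E mtK msK.
Qed.

Definition ac_arc a (r : nat) (i : 'I_r.*2) :=
  if odd i then mt (iter i./2 phi a) else iter i./2 phi a.

(** Arcs at positions of equal parity differ because the exponents stay below the order of [a], and
    arcs at positions of different parity by [mate_next_forward_neq]. The sequence closes up because
    [phi] iterated [r] times fixes [a]. *)
Lemma ac_arcP a : let r := fingraph.order phi a in
  alternating_cycle (@ac_arc a r).
Proof.
move=> r; have r0 : 0 < r by apply: fingraph.order_gt0.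
have phi_inj : injective phi := next_forward_inj.
have half_lt (i : 'I_r.*2) : i./2 < r.
  rewrite -ltn_double (leq_ltn_trans _ (ltn_ord i)) //.
  by rewrite -{2}(odd_double_half i) leq_addl.
have iter_eq k l : k < r -> l < r -> iter k phi a = iter l phi a -> k = l.
  by move=> kr lr E; rewrite -(findex_iter kr) -(findex_iter lr) E.
have iter_mt k l : mt (iter k phi a) <> iter l phi a.
  (* Applying the involution [mt] to the equation exchanges [k] and [l]. *)
  wlog kl : k l / k <= l => [hw|].
    case: (leqP k l) => [|/ltnW lk E]; first exact: hw.
    by apply: (hw l k lk); rewrite -E mtK.
  move=> E; have /eqP := mate_next_forward_neq (l - k) (iter k phi a); apply.
  by rewrite -iterD subnK // -E mtK.
split=> // [i j|i].
  rewrite /ac_arc => E; apply: val_inj => /=.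
  rewrite -(odd_double_half i) -(odd_double_half j).
  case: (odd i) (odd j) E => [] [];
    [move/(mate_inj card_tgt)| |move/esym|] => [/iter_eq->|/iter_mt|/iter_mt|/iter_eq->] //.
have ordSE : (ordS i : nat) = if i.+1 == r.*2 then 0 else i.+1.
  rewrite /=; case: eqP => [->|/eqP ne]; first by rewrite modnn.
  by rewrite modn_small // ltn_neqAle ne ltn_ord.
(* The index can wrap around only at an odd position, since the length is even. *)
rewrite /ac_arc ordSE; case: (boolP (odd i)) => oi; last first.
  case: eqP => [E|_]; first by have := congr1 odd E; rewrite odd_double /= oi.
  by rewrite /= oi /= uphalfE /= uphalf_half (negbTE oi) (mateP card_tgt _).1.
transitivity (src (iter i.+1./2 phi a)).
  by rewrite /= uphalf_half oi /= {2}/phi /next_forward (mateP card_src _).1.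
case: eqP => [->|_]; last by rewrite /= oi.
by rewrite doubleK fingraph.iter_order.
Qed.

Definition factor_like M := transversal (@src D) M /\ transversal (@tgt D) M.

(** From left to right, the alternating cycle through [a] shows that membership in [M] flips under
    [mt] and is kept by [phi], hence flips under [ms], as [ms b = phi (mt b)]. Conversely,
    consecutive arcs of an alternating cycle are mates, so membership alternates and is decided by
    the first arc. *)
Lemma factorP M : factor M <-> factor_like M.
Proof.
split=> [fM|[/(transversalP card_src) sM /(transversalP card_tgt) tM]
            r e [r0 e_inj eP]].
  have main a : (mt a \in M) = (a \notin M) /\ (phi a \in M) = (a \in M).
    pose r := fingraph.order phi a.
    have r0 : 0 < r by apply: fingraph.order_gt0.
    have r20 : 0 < r.*2 by rewrite double_gt0.
    have r21 : 1 < r.*2 by rewrite -[1%N]/(0.*2.+1) ltn_Sdouble.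
    pose e := @ac_arc a r.
    have e0 : e (Ordinal r20) = a by [].
    (* Position 2 carries [phi a], except when [r = 1]: then [phi a = a] sits at position 0. *)
    have [i [oi ei]] : exists i : 'I_r.*2, ~~ odd i /\ e i = phi a.
      have := r0; rewrite leq_eqVlt => /orP[/eqP r1|r1].
        exists (Ordinal r20); split=> //.
        by rewrite e0 -[LHS](fingraph.iter_order next_forward_inj) -/phi -/r -r1.
      have r22 : 2 < r.*2 by rewrite -[2]/(1.*2) ltn_double.
      by exists (Ordinal r22).
    have fa : a \in forward_arcs e by apply/imsetP; exists (Ordinal r20); rewrite ?inE.
    have fp : phi a \in forward_arcs e by apply/imsetP; exists i; rewrite ?inE.
    have bm : mt a \in backward_arcs e
      by apply/imsetP; exists (Ordinal r21); rewrite ?inE.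
    case: (fM _ _ (ac_arcP a)) => -[/subsetP sub /pred0P dis].
      by move: (dis (mt a)) => /=; rewrite bm /= => ->; rewrite !sub.
    move: (dis a) (dis (phi a)) => /=; rewrite fa fp /= => -> ->.
    by rewrite sub.
  have mtM a : (mt a \in M) = (a \notin M) by case: (main a).
  split; first apply/(transversalP card_src) => a; last exact/(transversalP card_tgt).
  by case: (main (mt a)); rewrite mtM /phi /next_forward mtK => _ ->.
(* Consecutive positions differ even for [r = 1], the length being at least 2; two distinct arcs
   with a common end must be mates. *)
have eM (i : 'I_r.*2) : (e (ordS i) \in M) = (e i \notin M).
  have ne : e (ordS i) <> e i.
    move/e_inj/(congr1 val) => /= E; move: (ltn_ord i).
    rewrite -ltn_double in r0.
    case: (ltngtP i.+1 r.*2) => [lt||eq] //.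
      by move: E; rewrite modn_small // => /eqP;
        rewrite -[X in _ == X]addn0 -addn1 eqn_add2l.
    by move: E; rewrite eq modnn => E0; move: r0 (odd_double r); rewrite -eq -E0.
  have := eP i; case: (odd i) => /esym E.
    by case: (mate_or card_src E) => // ->; apply: sM.
  by case: (mate_or card_tgt E) => // ->; apply: tM.
have r20 : 0 < r.*2 by rewrite double_gt0.
pose i0 := Ordinal r20.
have eiM (i : 'I_r.*2) : (e i \in M) = (e i0 \in M) (+) odd i.
  case: i => k kr; elim: k kr => [|k IH] kr.
    by rewrite addbF; congr (e _ \in M); apply: val_inj.
  have kr' := ltnW kr.
  have -> : e (Ordinal kr) = e (ordS (Ordinal kr')).
    by congr e; apply: val_inj; rewrite /= modn_small.
  by rewrite eM IH -addbN.
case: (boolP (e i0 \in M)) => e0; [left|right]; split.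
- by apply/subsetP => a /imsetP[i]; rewrite inE => oi ->; rewrite eiM e0 (negbTE oi).
- by apply/pred0P => a /=; apply/andP => -[/imsetP[i]]; rewrite inE => oi ->;
    rewrite eiM e0 oi.
- by apply/subsetP => a /imsetP[i]; rewrite inE => oi ->; rewrite eiM (negbTE e0) oi.
- by apply/pred0P => a /=; apply/andP => -[/imsetP[i]]; rewrite inE => oi ->; rewrite
    eiM (negbTE e0) (negbTE oi).
Qed.

(** * Parity of the open routes *)

Section Parity.
Variables (I : finType) (en ex : I -> vertex D).
Hypotheses (term : terminals en ex) (D_odd : all_ACs_odd D).

(* [s'] followed by the inverse of [s] moves, on each alternating cycle where
   M and M' differ, the start-vertices of its arcs along a cycle whose length is
   half that of the alternating cycle, hence odd. *)
Lemma odd_perm_closes M M' s s' : factor_like M -> factor_like M' ->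
  closes en ex M s -> closes en ex M' s' -> odd_perm s = odd_perm s'.
Proof.
move=> [srcM tgtM] [srcM' tgtM'] sM s'M'.
have mtM := (transversalP card_tgt M).1 tgtM.
have mtM' := (transversalP card_tgt M').1 tgtM'.
have msM := (transversalP card_src M).1 srcM.
have msM' := (transversalP card_src M').1 srcM'.
suff: ~~ odd_perm (s' * s^-1).
  by rewrite odd_permM odd_permV; case: (odd_perm s) (odd_perm s') => [] [].
apply: even_perm_odd_periods => v.
case: (src_or_ex term srcM' v) => [[a aM' <-]|[i ->]]; last first.
  by exists 1%N; rewrite // expg1 permM s'M'.1 -sM.1 permK.
case: (boolP (a \in M)) => aM.
  by exists 1%N; rewrite // expg1 permM s'M'.2 // -sM.2 // permK.
exists (fingraph.order phi a); first exact: D_odd (ac_arcP a).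
have step b : b \in M' -> b \notin M ->
    [/\ phi b \in M', phi b \notin M & (s' * s^-1) (src b) = src (phi b)].
  move=> bM' bM; have mbM : mt b \in M by rewrite mtM.
  rewrite msM' msM mtM' mtM bM' bM; split=> //.
  rewrite permM s'M'.2 // (mateP card_src _).1 -/mt.
  by rewrite -(mateP card_tgt b).1 -/mt -sM.2 // permK.
have H k : [/\ iter k phi a \in M', iter k phi a \notin M &
            ((s' * s^-1) ^+ k) (src a) = src (iter k phi a)].
  elim: k => [|k [IH1 IH2 IH3]]; first by rewrite expg0 perm1.
  by rewrite iterS expgSr permM IH3; apply: step.
have [_ _ ->] := H (fingraph.order phi a).
by rewrite fingraph.iter_order //; apply: next_forward_inj.
Qed.

(** By definition [odd_perm] adds the parities of the size of the set and of the number of orbits. A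
    route and its closing permutation have equally many orbits, and the sizes cancel on both
    sides. *)
Lemma odd_perm_route M M' (p p' : {perm I}) : factor_like M -> factor_like M' ->
    terminating ex M -> terminating ex M' ->
    (forall i, connect (arc_rel M) (en i) (ex (p i))) ->
    (forall i, connect (arc_rel M') (en i) (ex (p' i))) ->
  odd_perm p = odd_perm p'.
Proof.
move=> fM fM' tM tM' pM p'M'.
have [s sM] := closes_exists term fM.1 fM.2.
have [s' sM'] := closes_exists term fM'.1 fM'.2.
have := odd_perm_closes fM fM' sM sM'; rewrite /odd_perm.
rewrite (card_porbits_closure term fM.1 sM tM pM).
by rewrite (card_porbits_closure term fM'.1 sM' tM' p'M') => /addbI ->.
Qed.

End Parity.
End AlternatingCycles.

(** * Hamiltonian cycles as permutations with one orbit *)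

Lemma map_uniq_inj (A B : eqType) (f : A -> B) (s : seq A) :
  uniq (map f s) -> {in s &, injective f}.
Proof.
elim: s => //= c s IH /andP[cs /IH f_inj] a b.
rewrite !inE => /predU1P[->|a_s] /predU1P[->|b_s] // E.
- by move: cs; rewrite E map_f.
- by move: cs; rewrite -E map_f.
- exact: f_inj.
Qed.

Lemma terminals_void (D : digraph) :
    (forall v, v \in codom (@src D)) -> (forall v, v \in codom (@tgt D)) ->
  terminals (of_void (vertex D)) (of_void (vertex D)).
Proof.
move=> srcD tgtD; split=> [[]|[]|v|v|[]] //; rewrite ?srcD ?tgtD;
  apply/esym/negP => /codomP[[]].
Qed.

(** Without terminals a closing permutation only follows arcs. The sources of a closed walk are a
    rearrangement of its targets, so the arcs of a Hamiltonian cycle are a transversal for both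
    maps. *)
Lemma hamiltonianP (D : digraph) (v0 : vertex D) :
    (forall v, v \in codom (@src D)) -> (forall v, v \in codom (@tgt D)) ->
  hamiltonian D <-> exists M s, [/\ transversal (@src D) M,
    transversal (@tgt D) M, closes (of_void _) (of_void _) M s &
    #|porbits s| == 1%N].
Proof.
move=> srcD tgtD.
have term := terminals_void srcD tgtD.
split=> [[c [c0 [u cw] c_uniq] c_all]|[M [s [srcM tgtM sM /card_porbits1P]]]]; last first.
  move/(_ v0) => s1.
  have [k|c [cc cM cE]] := orbit_dicycle (s := s) (M := M) (v := v0).
    case: (src_or_ex term srcM (iter k s v0)) => [[a aM aE]|[[]]].
    by rewrite iterS -aE sM.2 // arc_rel_arc.
  exists c => // v; rewrite cE -fconnect_orbit.
  have /porbitP[k ->] : v \in porbit s (s v0).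
    by apply: porbit_trans (s1 v) _; rewrite porbit_sym mem_porbit1.
  by rewrite permX fconnect_iter.
have perm_c := closed_walk_src cw.
have trM (f : arc D -> vertex D) : uniq (map f c) -> (forall v, v \in map f c) ->
    transversal f [set a in c].
  move=> f_uniq f_all; split=> [a b|a].
    by rewrite !inE; apply: map_uniq_inj.
  by have /mapP[b bc ->] := f_all (f a); exists b; rewrite ?inE.
have tgtM : transversal (@tgt D) [set a in c] by apply: trM.
have srcM : transversal (@src D) [set a in c].
  by apply: trM => [|v]; rewrite ?(perm_uniq perm_c) ?(perm_mem perm_c).
have [s sM] := closes_exists term srcM tgtM.
exists [set a in c], s; split=> //; apply/(@card_porbits1P _ _ u) => v.
apply: (connect_closes sM); apply: (path_connect (p := map (@tgt D) c)).
  by apply: diwalk_path cw _ => a; rewrite inE.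
by rewrite !inE c_all orbT.
Qed.

(** * Transfer of transversals and reachability to quotients and sums *)

(** Only the kernel of the map matters, so a quotient of the vertices that merges no two sources
    keeps the transversals. *)
Lemma eq_transversal (A B C : finType) (f : A -> B) (g : A -> C) M :
  (forall a b, f a = f b <-> g a = g b) -> transversal f M <-> transversal g M.
Proof.
move=> fg; split=> -[inj ex]; split=> [a b aM bM /fg|a]; try exact: inj.
  by have [b bM /fg] := ex a; exists b.
by have [b bM /fg] := ex a; exists b.
Qed.

Lemma connect_embed (T U : finType) (e : rel T) (e' : rel U) (h : T -> U) :
    (forall u w, e' (h u) w <-> exists2 v, w = h v & e u v) ->
  forall u w, connect e' (h u) w <-> exists2 v, w = h v & connect e u v.
Proof.
move=> hE u w; split=> [/connectP[p + ->]|[v -> /connectP[p + ->]]].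
  elim: p u => [|w' p IH] u /=; first by exists u; rewrite ?connect0.
  case/andP=> /hE[v -> uv] /IH[z -> vz]; exists z => //.
  exact: connect_trans (connect1 uv) vz.
elim: p u => [|v' p IH] u /=; first by rewrite connect0.
case/andP=> uv /IH; apply: connect_trans; apply: connect1.
by apply/hE; exists v'.
Qed.

Section SumTransversal.
Variables (A A' B B' : finType) (f : A -> B) (f' : A' -> B').

Definition sum_map (a : A + A') : B + B' :=
  match a with inl a => inl (f a) | inr a => inr (f' a) end.

Lemma transversal_sum (M : {set (A + A')%type}) :
  transversal sum_map M <->
    transversal f (inl @^-1: M) /\ transversal f' (inr @^-1: M).
Proof.
split=> [[inj ex]|[[inj ex] [inj' ex']]].
  split; split.
  - move=> a b; rewrite !inE => aM bM fab.
    by have [] := inj (inl a) (inl b) aM bM (congr1 inl fab).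
  - by move=> a; have [[b|b] bM //= [E]] := ex (inl a); exists b; rewrite ?inE.
  - move=> a b; rewrite !inE => aM bM fab.
    by have [] := inj (inr a) (inr b) aM bM (congr1 inr fab).
  - by move=> a; have [[b|b] bM //= [E]] := ex (inr a); exists b; rewrite ?inE.
split=> [[a|a] [b|b] aM bM //= [E]|[a|a]].
- by rewrite (inj a b) ?inE.
- by rewrite (inj' a b) ?inE.
- by have [b] := ex a; rewrite inE => bM /= <-; exists (inl b).
- by have [b] := ex' a; rewrite inE => bM /= <-; exists (inr b).
Qed.

End SumTransversal.

(** * Open routes of a labelled digraph *)

Lemma codom_label n (T : finType) (A : {set T}) (l : labelling n A) :
  codom l =i A.
Proof.
move=> v; have /setP/(_ v) <- := label_im l.
by apply/codomP/imsetP => [[i ->]|[i _ ->]]; exists i.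
Qed.

Lemma two_digraph_terminals n (F : labelled_digraph n) :
  two_digraph F -> terminals (entry F) (Defs.exit F).
Proof.
move=> F2.
have enE := codom_label (entry F); have exE := codom_label (Defs.exit F).
have tgtE v : (v \in codom (@tgt F)) = (indeg v != 0%N).
  rewrite -lt0n; apply/codomP/card_gt0P => [[a ->]|[a]]; last first.
    by rewrite inE => /eqP <-; exists a.
  by exists a; rewrite inE.
have srcE v : (v \in codom (@src F)) = (outdeg v != 0%N).
  rewrite -lt0n; apply/codomP/card_gt0P => [[a ->]|[a]]; last first.
    by rewrite inE => /eqP <-; exists a.
  by exists a; rewrite inE.
split; try exact: label_inj.
- move=> v; rewrite tgtE enE; have := F2 v; rewrite !inE.
  by case/or3P => /andP[/eqP-> /eqP->].
- move=> v; rewrite srcE exE; have := F2 v; rewrite !inE.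
  by case/or3P => /andP[/eqP-> /eqP->].
move=> i j; apply/eqP => E.
have : entry F i \in exits F by rewrite E -exE codom_f.
have : entry F i \in entries F by rewrite -enE codom_f.
by rewrite !inE => /andP[/eqP-> _].
Qed.

Lemma open_routesP n (F : labelled_digraph n) (p : 'S_n) : two_digraph F ->
  p \in open_routes F <-> exists M, [/\ factor_like M,
    terminating (Defs.exit F) M &
    forall i, connect (arc_rel M) (entry F i) (Defs.exit F (p i))].
Proof.
move=> F2; have term := two_digraph_terminals F2.
rewrite inE; split=> [/asboolP[M [/(factorP F2) fM aM] pM]|[M [fM tM pM]]].
  exists M; split=> // [|i]; first exact/(acyclic_terminating term fM.1 fM.2).
  by apply/connect_dipath.
apply/asboolP; exists M; last by move=> i; apply/connect_dipath.
split; first exact/(factorP F2).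
exact/(acyclic_terminating term fM.1 fM.2).
Qed.

(** * The splice as a quotient of the disjoint union *)

Section Splice.
Variables (n : nat) (F F' : labelled_digraph n) (x y : 'S_n).
Hypotheses (n_gt0 : 0 < n) (F2 : two_digraph F) (F'2 : two_digraph F').

(** It has the very arcs of the splice, so sets of arcs need no translation, and the gluing becomes
    the jump of a closing permutation. *)
Definition disjoint_union : digraph :=
  Digraph (sum_map (@src F) (@src F')) (sum_map (@tgt F) (@tgt F')).
Let D := disjoint_union.
Let G := splice F F' x y.

(* The label i of a side of the splice stands for exit i of that side and for the
   entry of the other side glued to it. *)
Definition union_exit (i : 'I_n + 'I_n) : vertex D :=
  match i with inl i => inl (Defs.exit F i) | inr i => inr (Defs.exit F' i) end.
Definition union_entry (i : 'I_n + 'I_n) : vertex D :=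
  match i with inl i => inr (entry F' (x i)) | inr i => inl (entry F (y i)) end.
Let ex := union_exit.
Let en := union_entry.

Lemma union_terminals : terminals en ex.
Proof.
have [en_inj ex_inj tE sE enex] := two_digraph_terminals F2.
have [en'_inj ex'_inj tE' sE' enex'] := two_digraph_terminals F'2.
split.
- by case=> i [] j //= [] => [/en'_inj|/en_inj] /perm_inj ->.
- by case=> i [] j //= [] => [/ex_inj|/ex'_inj] ->.
- case=> v.
    transitivity (v \in codom (@tgt F)).
      by apply/codomP/codomP => [[[a|a] // [->]]|[a ->]]; [exists a|exists (inl a)].
    rewrite tE; congr negb; apply/codomP/codomP => [[i ->]|[[i|i] // [->]]].
      by exists (inr (y^-1 i)); rewrite /= permKV.
    by exists (y i).
  transitivity (v \in codom (@tgt F')).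
    by apply/codomP/codomP => [[[a|a] // [->]]|[a ->]]; [exists a|exists (inr a)].
  rewrite tE'; congr negb; apply/codomP/codomP => [[i ->]|[[i|i] // [->]]].
    by exists (inl (x^-1 i)); rewrite /= permKV.
  by exists (x i).
- case=> v.
    transitivity (v \in codom (@src F)).
      by apply/codomP/codomP => [[[a|a] // [->]]|[a ->]]; [exists a|exists (inl a)].
    rewrite sE; congr negb; apply/codomP/codomP => [[i ->]|[[i|i] // [->]]].
      by exists (inl i).
    by exists i.
  transitivity (v \in codom (@src F')).
    by apply/codomP/codomP => [[[a|a] // [->]]|[a ->]]; [exists a|exists (inr a)].
  rewrite sE'; congr negb; apply/codomP/codomP => [[i ->]|[[i|i] // [->]]].
    by exists (inr i).
  by exists i.
- by case=> i [] j //=; apply/eqP => -[E];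
    [have := enex' (x i) j | have := enex (y i) j]; rewrite E eqxx.
Qed.

Let cls : vertex D -> vertex G := @splice_class n F F' x y.

Lemma glueE (u v : vertex D) :
  glue x y u v <-> exists i, (u = ex i /\ v = en i) \/ (v = ex i /\ u = en i).
Proof.
split.
  case: u v => [u|u] [v|v] //= /orP[] /existsP[i /andP[/eqP-> /eqP->]];
    by [exists (inl i); auto | exists (inr i); auto].
case=> -[i|i] [[-> ->]|[-> ->]] /=; apply/orP; [left|left|right|right];
  by apply/existsP; exists i; rewrite !eqxx.
Qed.

Lemma clsE u v : cls u = cls v <-> connect (glue x y) u v.
Proof. by split=> [/eqmodP|uv] //; apply/eqmodP. Qed.

Lemma cls_surj w : exists u, cls u = w.
Proof. by exists (generic_quotient.repr w); rewrite /cls /splice_class reprK. Qed.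

Lemma cls_ex i : cls (ex i) = cls (en i).
Proof. by apply/clsE/connect1/glueE; exists i; left. Qed.

Lemma cls_invariant (T : eqType) (k : vertex D -> T) :
  (forall i, k (ex i) = k (en i)) -> forall u v, cls u = cls v -> k u = k v.
Proof.
move=> kE u v /clsE/connectP[p + ->]; elim: p u => //= w p IH u.
by case/andP=> /glueE[i [[-> ->]|[-> ->]]] /IH <-.
Qed.

(** The function [k] replaces an exit by the entry glued to it. It is constant on classes and fixes
    every source, as no source is an exit. *)
Lemma cls_src (a b : arc D) : cls (src a) = cls (src b) <-> src a = src b.
Proof.
split=> [E|->//].
have [_ ex_inj _ _ enex] := union_terminals.
pose k v := if [pick i | ex i == v] is Some i then en i else v.
have kE v : (forall i, v <> ex i) -> k v = v.
  by move=> vex; rewrite /k; case: pickP => // i /eqP/esym/vex.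
have := @cls_invariant _ k _ _ _ E; rewrite !kE; first apply.
- move=> i; rewrite [k (en i)]kE => [|j]; last exact/eqP/enex.
  by rewrite /k; case: pickP => [j /eqP/ex_inj->|/(_ i)]; rewrite ?eqxx.
- by move=> i /(src_ex union_terminals).
- by move=> i /(src_ex union_terminals).
Qed.

Lemma cls_tgt (a b : arc D) : cls (tgt a) = cls (tgt b) <-> tgt a = tgt b.
Proof.
split=> [E|->//].
have [en_inj _ _ _ enex] := union_terminals.
pose k v := if [pick i | en i == v] is Some i then ex i else v.
have kE v : (forall i, v <> en i) -> k v = v.
  by move=> ven; rewrite /k; case: pickP => // i /eqP/esym/ven.
have := @cls_invariant _ k _ _ _ E; rewrite !kE; first apply.
- move=> i; rewrite [k (ex i)]kE => [|j /esym]; last exact/eqP/enex.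
  by rewrite /k; case: pickP => [j /eqP/en_inj->|/(_ i)]; rewrite ?eqxx.
- by move=> i /(tgt_en union_terminals).
- by move=> i /(tgt_en union_terminals).
Qed.

Lemma splice_src (w : vertex G) : w \in codom (@src G).
Proof.
have [_ _ _ sE enex] := union_terminals; have [u <-] := cls_surj w.
have src_cls v : v \notin codom ex -> cls v \in codom (@src G).
  by rewrite -sE => /codomP[a ->]; apply/codomP; exists a; case: a.
case: (boolP (u \in codom ex)) => [/codomP[i ->]|]; last exact: src_cls.
rewrite cls_ex src_cls //; apply/codomP => -[j].
exact/eqP/enex.
Qed.

Lemma splice_tgt (w : vertex G) : w \in codom (@tgt G).
Proof.
have [_ _ tE _ enex] := union_terminals; have [u <-] := cls_surj w.
have tgt_cls v : v \notin codom en -> cls v \in codom (@tgt G).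
  by rewrite -tE => /codomP[a ->]; apply/codomP; exists a; case: a.
case: (boolP (u \in codom en)) => [/codomP[i ->]|]; last exact: tgt_cls.
rewrite -cls_ex tgt_cls //; apply/codomP => -[j /esym].
exact/eqP/enex.
Qed.

Lemma srcG (a : arc D) : @src G a = cls (src a). Proof. by case: a. Qed.
Lemma tgtG (a : arc D) : @tgt G a = cls (tgt a). Proof. by case: a. Qed.

Lemma splice_transversal_src (M : {set arc D}) :
  transversal (@src G) M <-> transversal (@src D) M.
Proof. by apply: eq_transversal => a b; rewrite !srcG cls_src. Qed.

Lemma splice_transversal_tgt (M : {set arc D}) :
  transversal (@tgt G) M <-> transversal (@tgt D) M.
Proof. by apply: eq_transversal => a b; rewrite !tgtG cls_tgt. Qed.

(** Gluing merges only [ex i] with [en i], which [s] already joins. Each class thus lies in one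
    orbit of [s], and passing to the quotient contracts the jumps without changing the number of
    orbits. *)
Lemma card_porbits_splice (M : {set arc D}) (s : {perm vertex D})
    (r : {perm vertex G}) :
    transversal (@src D) M -> closes en ex M s ->
    @closes G _ (of_void _) (of_void _) M r ->
  #|porbits s| = #|porbits r|.
Proof.
move=> srcM sM rM.
have srcGM := (splice_transversal_src M).2 srcM.
have cls_orb u v : cls u = cls v -> u \in porbit s v.
  move=> E; rewrite -eq_porbit_mem; apply/eqP; apply: cls_invariant E => i.
  by apply/eqP; rewrite eq_porbit_mem porbit_sym -sM.1 mem_porbit1.
have [k kK] := fin_all_exists cls_surj.
apply: (@card_porbits_semiconj _ _ _ _ cls k) => [w|u|u|w] //.
- case: (src_or_ex union_terminals srcM u) => [[a aM <-]|[i ->]].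
    by rewrite sM.2 // -srcG -tgtG -rM.2 // mem_porbit1.
  by rewrite sM.1 cls_ex porbit_id.
- exact/cls_orb/kK.
- have [a aM aw] : exists2 a : arc D, a \in M & cls (src a) = w.
    have /codomP[b ->] := splice_src w; have [a aM <-] := srcGM.2 b.
    by exists a; rewrite ?srcG.
  have aE : src a \in porbit s (k w) by apply: cls_orb; rewrite kK.
  apply: porbit_trans aE; apply: porbit_trans (mem_porbit1 s (src a)).
  by apply: cls_orb; rewrite kK sM.2 // -aw -srcG rM.2 ?tgtG.
Qed.

Lemma hamiltonian_union : hamiltonian G <-> exists (M : {set arc D}) s,
  [/\ transversal (@src D) M, transversal (@tgt D) M, closes en ex M s &
      #|porbits s| == 1%N].
Proof.
have w0 : vertex G := cls (inl (entry F (Ordinal n_gt0))).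
have termG := terminals_void splice_src splice_tgt.
apply: (iff_trans (hamiltonianP w0 splice_src splice_tgt)).
split=> [[M [r [/splice_transversal_src srcM /splice_transversal_tgt tgtM rM r1]]]|
         [M [s [srcM tgtM sM s1]]]].
  have [s sM] := closes_exists union_terminals srcM tgtM.
  by exists M, s; split=> //; rewrite (card_porbits_splice srcM sM rM).
have srcM' := (splice_transversal_src M).2 srcM.
have tgtM' := (splice_transversal_tgt M).2 tgtM.
have [r rM] := closes_exists termG srcM' tgtM'.
by exists M, r; split=> //; rewrite -(card_porbits_splice srcM sM rM).
Qed.

Lemma connect_inl (M : {set arc D}) u w :
  connect (@arc_rel D M) (inl u) w <->
    exists2 v, w = inl v & connect (@arc_rel F (inl @^-1: M)) u v.
Proof.
apply: connect_embed u w => u w; split.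
  case/arc_relP=> -[a|a] [aM // [<-] <-]; exists (tgt a) => //.
  by apply: arc_rel_arc; rewrite inE.
case=> v -> /arc_relP[a [aM <- <-]]; apply/arc_relP; exists (inl a).
by rewrite inE in aM.
Qed.

Lemma connect_inr (M : {set arc D}) u w :
  connect (@arc_rel D M) (inr u) w <->
    exists2 v, w = inr v & connect (@arc_rel F' (inr @^-1: M)) u v.
Proof.
apply: connect_embed u w => u w; split.
  case/arc_relP=> -[a|a] [aM // [<-] <-]; exists (tgt a) => //.
  by apply: arc_rel_arc; rewrite inE.
case=> v -> /arc_relP[a [aM <- <-]]; apply/arc_relP; exists (inr a).
by rewrite inE in aM.
Qed.

Lemma terminating_union (M : {set arc D}) : terminating ex M <->
  terminating (Defs.exit F) (inl @^-1: M) /\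
  terminating (Defs.exit F') (inr @^-1: M).
Proof.
split=> [tM|[tM tM'] [v|v]].
- split=> v.
    by have [[i|i] /connect_inl[w // [<-]]] := tM (inl v); exists i.
  by have [[i|i] /connect_inr[w // [<-]]] := tM (inr v); exists i.
- have [i iM] := tM v; exists (inl i); apply/connect_inl.
  by exists (Defs.exit F i).
- have [i iM] := tM' v; exists (inr i); apply/connect_inr.
  by exists (Defs.exit F' i).
Qed.

Lemma card_porbits_union (M : {set arc D}) (s : {perm vertex D}) (p q : 'S_n) :
    transversal (@src D) M -> closes en ex M s -> terminating ex M ->
    (forall i, connect (@arc_rel F (inl @^-1: M)) (entry F i) (Defs.exit F (p i))) ->
    (forall i, connect (@arc_rel F' (inr @^-1: M)) (entry F' i) (Defs.exit F' (q i))) ->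
  #|porbits s| = #|porbits (p * x * q * y)|.
Proof.
move=> srcM sM tM pM qM.
(* The route of the union: exit [i] of [F] is glued to entry [x i] of [F'], whose path ends at exit
   [q (x i)], and likewise from [F'] back to [F]. *)
pose f (i : 'I_n + 'I_n) : 'I_n + 'I_n :=
  match i with inl i => inr (q (x i)) | inr i => inl (p (y i)) end.
have f_inj : injective f.
  by case=> i [] j //= [] /perm_inj/perm_inj ->.
have rM i : connect (arc_rel M) (en i) (ex (perm f_inj i)).
  rewrite permE; case: i => i /=; [apply/connect_inr|apply/connect_inl].
    by exists (Defs.exit F' (q (x i))).
  by exists (Defs.exit F (p (y i))).
rewrite (card_porbits_closure union_terminals srcM sM tM rM).
rewrite -!mulgA (card_porbitsC p) !mulgA.
(* Since [f] alternates sides, its square acts on the left labels as [x * q * y * p]; [l] moves a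
   right label to the left one by one application of [f]. *)
pose l (i : 'I_n + 'I_n) := match i with inl i => i | inr i => p (y i) end.
apply: (@card_porbits_semiconj _ _ _ _ l inl) => [i|[i|i]|[i|i]|i] //.
- have := mem_porbit1 (x * q * y * p) i; rewrite permE /= !permM; apply.
- by rewrite permE porbit_id.
- by rewrite porbit_id.
- by have := mem_porbit1 (perm f_inj) (inr i); rewrite [X in X \in _]permE.
- have := mem_porbit (perm f_inj) 2 (inl i).
  by rewrite expgS expg1 permM !permE /= !permM.
Qed.

Lemma hamiltonian_splice : hamiltonian G <-> exists p q,
  [/\ p \in open_routes F, q \in open_routes F' &
      p * x * q * y \in full_cycles n].
Proof.
apply: (iff_trans hamiltonian_union); split.
  case=> M [s [srcM tgtM sM s1]].
  (* The single orbit contains an exit, one existing because [0 < n], so every vertex reaches an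
     exit within [M]. *)
  have tM : terminating ex M.
    apply: (porbit_terminating union_terminals srcM sM) => v.
    by exists (inl (Ordinal n_gt0)); apply/card_porbits1P.
  have [srcM1 srcM2] := (transversal_sum _ _ _).1 srcM.
  have [tgtM1 tgtM2] := (transversal_sum _ _ _).1 tgtM.
  have [tM1 tM2] := (terminating_union M).1 tM.
  have [p pM] := route_exists (two_digraph_terminals F2) tgtM1 tM1.
  have [q qM] := route_exists (two_digraph_terminals F'2) tgtM2 tM2.
  exists p, q; split; first by apply/(open_routesP _ F2); exists (inl @^-1: M).
    by apply/(open_routesP _ F'2); exists (inr @^-1: M).
  by rewrite inE -(card_porbits_union srcM sM tM pM qM).
case=> p [q [/(open_routesP _ F2)[M1 [[srcM1 tgtM1] tM1 pM]]
             /(open_routesP _ F'2)[M2 [[srcM2 tgtM2] tM2 qM]] pq]].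
pose M : {set arc D} :=
  [set a : arc F + arc F' | match a with inl a => a \in M1 | inr a => a \in M2 end].
have ME1 : inl @^-1: M = M1 by apply/setP => a; rewrite !inE.
have ME2 : inr @^-1: M = M2 by apply/setP => a; rewrite !inE.
have srcM : transversal (@src D) M by apply/transversal_sum; rewrite ME1 ME2.
have tgtM : transversal (@tgt D) M by apply/transversal_sum; rewrite ME1 ME2.
have tM : terminating ex M by apply/terminating_union; rewrite ME1 ME2.
have [s sM] := closes_exists union_terminals srcM tgtM.
exists M, s; split=> //; rewrite inE in pq.
by rewrite (card_porbits_union srcM sM tM (p := p) (q := q)) ?ME1 ?ME2.
Qed.

End Splice.

(** * Residues, the parity condition and the equivalence *)

Lemma odd_perm_open_route n (F : labelled_digraph n) (p : 'S_n) :
    two_digraph F -> all_ACs_odd F -> p \in open_routes F ->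
  odd_perm p = set_parity (open_routes F).
Proof.
move=> F2 F_odd pP.
have sameP q : q \in open_routes F -> odd_perm q = odd_perm p.
  move: pP => /(open_routesP _ F2)[M [fM tM pM]].
  case/(open_routesP _ F2)=> M' [fM' tM' qM'].
  exact: (odd_perm_route F2 (two_digraph_terminals F2) F_odd fM' fM tM' tM qM' pM).
rewrite /set_parity; case: (boolP (odd_perm p)) => op; apply/esym.
  by apply/negP => /subsetP/(_ p pP); rewrite Alt_even op.
apply/negbF/subsetP => q qP.
by rewrite Alt_even sameP.
Qed.

Lemma mem_residue n (P : {set 'S_n}) (z : 'S_n) :
  z \in residue P =
    (odd_perm z == (set_parity P == odd n)) && (z \notin excluded_set P).
Proof.
rewrite /residue; case: (set_parity P == odd n);
  rewrite in_setD ?in_setC Alt_even andbC.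
  by case: (odd_perm z).
by case: (odd_perm z).
Qed.

Lemma mem_excluded n (P : {set 'S_n}) (z : 'S_n) :
  z \in excluded_set P <-> exists2 p, p \in P & p * z \in full_cycles n.
Proof.
split=> [/imset2P[q c]|[p pP pz]].
  by rewrite inE => qP cC ->; exists q^-1; rewrite // mulKg.
by apply/imset2P; exists p^-1 (p * z); rewrite ?memV_invg ?mulKg.
Qed.

Lemma full_cyclesC n (a b : 'S_n) :
  (a * b \in full_cycles n) = (b * a \in full_cycles n).
Proof. by rewrite !inE card_porbitsC. Qed.

(** The parity condition states that [x * q * y] lies in the parity class from which the residue of
    [P] is cut out. What remains is to avoid the excluded set. *)
Lemma coset_sub_residue n (P Q : {set 'S_n}) (x y : 'S_n) :
    parity_condition P Q x y -> {in Q, forall q, odd_perm q = set_parity Q} ->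
  x *: Q :* y \subset residue P <->
  forall p q, p \in P -> q \in Q -> p * x * q * y \notin full_cycles n.
Proof.
move=> par Qpar; split=> [/subsetP sub p q pP qQ|H].
  have := sub (x * q * y); rewrite mem_residue mem_rcoset mulgK mem_lcoset mulKg.
  case/(_ qQ)/andP => _; apply: contra => c.
  by apply/mem_excluded; exists p; rewrite // !mulgA.
apply/subsetP => z /rcosetP[w /lcosetP[q qQ ->] ->]; rewrite mem_residue.
apply/andP; split; last first.
  by apply/negP => /mem_excluded[p pP]; rewrite !mulgA; apply/negP/H.
rewrite !odd_permM (Qpar q qQ).
by case: par => -[]; case: (odd n) (set_parity P) (set_parity Q)
  (odd_perm x) (odd_perm y) => [] [] [] [] [].
Qed.

Theorem theorem1 (n : nat) (F F' : labelled_digraph n) (x y : 'S_n) :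
  0 < n ->
  two_digraph F -> connected F -> open_digraph F -> all_ACs_odd F ->
  two_digraph F' -> connected F' -> open_digraph F' -> all_ACs_odd F' ->
  let P := open_routes F in
  let Q := open_routes F' in
  let G := splice F F' x y in
  parity_condition P Q x y ->
  [<-> ~ hamiltonian G;
       x *: Q :* y \subset residue P;
       y *: P :* x \subset residue Q].
Proof.
move=> n_gt0 F2 _ _ F_odd F'2 _ _ F'_odd P Q G par.
have Ppar : {in P, forall p, odd_perm p = set_parity P}.
  by move=> p; apply: odd_perm_open_route.
have Qpar : {in Q, forall q, odd_perm q = set_parity Q}.
  by move=> q; apply: odd_perm_open_route.
have par' : parity_condition Q P y x.
  by case: par => -[nE PQ xy]; [constructor 1|constructor 2|constructor 3|constructor 4];
    split=> // E; [apply: xy|apply: PQ|apply: PQ|apply: xy].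
have subP := coset_sub_residue par Qpar; have subQ := coset_sub_residue par' Ppar.
have ham := hamiltonian_splice x y n_gt0 F2 F'2.
(* Rotating the four factors cyclically is a conjugation. *)
have rot p q : (q * y * p * x \in full_cycles n) = (p * x * q * y \in full_cycles n).
  by rewrite -(mulgA (q * y)) (full_cyclesC (q * y)) !mulgA.
tfae.
- move=> nh; apply/subP => p q pP qQ; apply/negP => c.
  by apply/nh/ham; exists p, q.
- by move=> /subP H; apply/subQ => q p qQ pP; rewrite rot H.
- by move=> /subQ H /ham[p [q [pP qQ]]]; rewrite -rot; apply/negP/H.
Qed.
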